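(* Let $(\mathcal A,\mathcal E)$ be a Frobenius exact category with stable category $\underline{\mathcal A}$, and let $(\mathcal I,\mathcal J)$ be an ideal cotorsion pair of object ideals in $\mathcal A$ such that the cotorsion pair of objects $(\mathcal F,\mathcal C)=(\mathrm{Ob}(\mathcal I),\mathrm{Ob}(\mathcal J))$ is of $t$-structure type. Suppose that $A\in\mathcal A$ has a special $\mathcal I$-precover. Then there are a conflation $$0\to C_0\xrightarrow{\iota}G\xrightarrow{q}A\to0$$ with $C_0\in\mathcal C$ and $q\in\mathcal I$, and morphisms $a:G\to F_0$, $v:F_0\to G$ and $t:G\to C_0$ with $F_0\in\mathcal F$ and $1_G=va+\iota t$, such that $\varepsilon=\underline{\iota t}$ is an idempotent endomorphism of $G$ in $\underline{\mathcal A}$. If $\varepsilon$ splits in $\underline{\mathcal A}$, in particular if $\underline{\mathcal A}$ is idempotent complete, then $A$ has a special $\mathcal F$-precover.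
   Context: Exact categories are in the sense of Quillen; $\mathrm{Ext}^1_{\mathcal A}$ is the Yoneda extension bifunctor. Frobenius means enough projectives and enough injectives, and these coincide; $\omega$ is the class of projective-injective objects. The stable category $\underline{\mathcal A}=\mathcal A/\omega$ has the same objects, with morphisms taken modulo those factoring through objects of $\omega$; $\underline f$ is the image of a morphism $f$ in $\underline{\mathcal A}$. It is triangulated with suspension $\Sigma$, where $\Sigma X$ is the cokernel of an inflation $X\to I$ with $I\in\omega$. A category is idempotent complete if every idempotent endomorphism splits. An ideal $\mathcal I$ of $\mathcal A$ is an additive subbifunctor of $\mathrm{Hom}_{\mathcal A}(-,-)$. $\mathrm{Ob}(\mathcal I)=\{X:1_X\in\mathcal I\}$; $\mathcal I$ is an object ideal if every morphism in $\mathcal I$ factors through an object of $\mathrm{Ob}(\mathcal I)$. For $f:X_0\to X_1$, $g:Y_0\to Y_1$, $\mathrm{Ext}^1_{\mathcal A}(f,g):\mathrm{Ext}^1_{\mathcal A}(X_1,Y_0)\to\mathrm{Ext}^1_{\mathcal A}(X_0,Y_1)$ is pullback along $f$ followed by pushout along $g$. Put ${}^\perp\mathcal J=\{f:\mathrm{Ext}^1_{\mathcal A}(f,g)=0\ \forall g\in\mathcal J\}$, $\mathcal I^\perp=\{g:\mathrm{Ext}^1_{\mathcal A}(f,g)=0\ \forall f\in\mathcal I\}$. $(\mathcal I,\mathcal J)$ is an ideal cotorsion pair if $\mathcal I={}^\perp\mathcal J$ and $\mathcal J=\mathcal I^\perp$. An $\mathcal I$-precover of $A$ is a morphism $p:E\to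 A$ in $\mathcal I$ through which every morphism in $\mathcal I$ with codomain $A$ factors. It is special if there are a conflation $0\to Y\to Z\to A\to0$ and $g:Y\to B$ in $\mathcal I^\perp$ whose pushout conflation is $0\to B\to E\xrightarrow{p}A\to0$. A pair of classes of objects $(\mathcal F,\mathcal C)$ is a cotorsion pair if $\mathcal F=\{X:\mathrm{Ext}^1_{\mathcal A}(X,C)=0\ \forall C\in\mathcal C\}$ and $\mathcal C=\{Y:\mathrm{Ext}^1_{\mathcal A}(F,Y)=0\ \forall F\in\mathcal F\}$ (this holds automatically for $(\mathrm{Ob}(\mathcal I),\mathrm{Ob}(\mathcal J))$ when $(\mathcal I,\mathcal J)$ is an ideal cotorsion pair of object ideals). A special $\mathcal F$-precover of $A$ is a conflation $0\to C\to F\to A\to0$ with $F\in\mathcal F$ and $C\in\mathcal C$. The pair is of $t$-structure type if $\mathrm{Hom}_{\underline{\mathcal A}}(F,C)=0$ for all $F\in\mathcal F$, $C\in\mathcal C$ (equivalently, $\Sigma\mathcal F\subseteq\mathcal F$). *)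

(* Defs.v *)
From HB Require Import structures.
From mathcomp Require Import all_boot ssralg ring_quotient.
From mathcomp Require Import boolp.

Set Implicit Arguments.
Unset Strict Implicit.
Unset Printing Implicit Defensive.

Import GRing.Theory.
Local Open Scope ring_scope.
Local Open Scope quotient_scope.

Reserved Notation "g \oc f" (at level 40, left associativity).

(* The decidable equality and choice operator that [zmodType] puts on the Hom
   groups are no restriction: classically every abelian group has them. *)
Record preadditive_cat := PreadditiveCat {
  Ob :> Type;
  Mor : Ob -> Ob -> zmodType;
  idm : forall X, Mor X X;
  mcomp : forall X Y Z, Mor Y Z -> Mor X Y -> Mor X Z;
  compA : forall W X Y Z (h : Mor Y Z) (g : Mor X Y) (f : Mor W X),
    mcomp h (mcomp g f) = mcomp (mcomp h g) f;
  comp1m : forall X Y (f : Mor X Y), mcomp (idm Y) f = f;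
  compm1 : forall X Y (f : Mor X Y), mcomp f (idm X) = f;
  compDl : forall X Y Z (g g' : Mor Y Z) (f : Mor X Y),
    mcomp (g + g') f = mcomp g f + mcomp g' f;
  compDr : forall X Y Z (g : Mor Y Z) (f f' : Mor X Y),
    mcomp g (f + f') = mcomp g f + mcomp g f' }.

Arguments Mor {_} _ _.
Arguments idm {_} X.
Arguments mcomp {_ _ _ _} g f.
Notation "g \oc f" := (mcomp g f) : ring_scope.

Section Preadditive.
Variable A : preadditive_cat.
Implicit Types W X Y Z : A.

Lemma comp0m X Y Z (f : Mor X Y) : (0 : Mor Y Z) \oc f = 0.
Proof. by apply: (addrI (0 \oc f)); rewrite -compDl !addr0. Qed.

Lemma compm0 X Y Z (g : Mor Y Z) : g \oc (0 : Mor X Y) = 0.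
Proof. by apply: (addrI (g \oc 0)); rewrite -compDr !addr0. Qed.

Lemma compNl X Y Z (g : Mor Y Z) (f : Mor X Y) : (- g) \oc f = - (g \oc f).
Proof. by apply: (addrI (g \oc f)); rewrite -compDl !subrr comp0m. Qed.

Lemma compNr X Y Z (g : Mor Y Z) (f : Mor X Y) : g \oc (- f) = - (g \oc f).
Proof. by apply: (addrI (g \oc f)); rewrite -compDr !subrr compm0. Qed.

Lemma compBl X Y Z (g g' : Mor Y Z) (f : Mor X Y) :
  (g - g') \oc f = g \oc f - g' \oc f.
Proof. by rewrite compDl compNl. Qed.

Lemma compBr X Y Z (g : Mor Y Z) (f f' : Mor X Y) :
  g \oc (f - f') = g \oc f - g \oc f'.
Proof. by rewrite compDr compNr. Qed.

Definition is_iso X Y (f : Mor X Y) :=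
  exists g : Mor Y X, g \oc f = idm X /\ f \oc g = idm Y.

Definition idempotent_mor X (e : Mor X X) := e \oc e = e.

Definition splits X (e : Mor X X) :=
  exists (Y : A) (r : Mor X Y) (s : Mor Y X), s \oc r = e /\ r \oc s = idm Y.

Definition is_zero_obj Z :=
  (forall X (f : Mor X Z), f = 0) /\ (forall X (f : Mor Z X), f = 0).

Record biproduct X Y := Biproduct {
  bi_obj : A;
  bi_in1 : Mor X bi_obj;
  bi_in2 : Mor Y bi_obj;
  bi_pr1 : Mor bi_obj X;
  bi_pr2 : Mor bi_obj Y;
  bi_pr1K : bi_pr1 \oc bi_in1 = idm X;
  bi_pr2K : bi_pr2 \oc bi_in2 = idm Y;
  bi_pr12 : bi_pr1 \oc bi_in2 = 0;
  bi_pr21 : bi_pr2 \oc bi_in1 = 0;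
  bi_sum : bi_in1 \oc bi_pr1 + bi_in2 \oc bi_pr2 = idm bi_obj }.

Definition is_kernel X Y Z (i : Mor X Y) (p : Mor Y Z) :=
  p \oc i = 0 /\
  forall W (h : Mor W Y), p \oc h = 0 -> exists! k : Mor W X, i \oc k = h.

Definition is_cokernel X Y Z (i : Mor X Y) (p : Mor Y Z) :=
  p \oc i = 0 /\
  forall W (h : Mor Y W), h \oc i = 0 -> exists! k : Mor Z W, k \oc p = h.

(* The square     X --i--> Y
                  |        |
                  g        h
                  v        v
                  X' --j-> Y'   is a pushout, resp. a pullback. *)
Definition is_pushout X Y X' Y' (i : Mor X Y) (g : Mor X X')
    (j : Mor X' Y') (h : Mor Y Y') :=
  h \oc i = j \oc g /\
  forall W (u : Mor Y W) (w : Mor X' W), u \oc i = w \oc g ->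
    exists! k : Mor Y' W, k \oc h = u /\ k \oc j = w.

Definition is_pullback X Y X' Y' (i : Mor X Y) (g : Mor X X')
    (j : Mor X' Y') (h : Mor Y Y') :=
  h \oc i = j \oc g /\
  forall W (u : Mor W Y) (w : Mor W X'), h \oc u = j \oc w ->
    exists! k : Mor W X, i \oc k = u /\ g \oc k = w.

(* A pair of composable morphisms Y -> mid -> X. *)
Record ses Y X := Ses {
  mid : A;
  infl : Mor Y mid;
  defl : Mor mid X }.

Definition kernel_cokernel Y X (s : ses Y X) :=
  is_kernel (infl s) (defl s) /\ is_cokernel (infl s) (defl s).

Definition ses_iso Y X Y' X' (s : ses Y X) (s' : ses Y' X') :=
  exists (a : Mor Y Y') (b : Mor (mid s) (mid s')) (c : Mor X X'),
    [/\ is_iso a, is_iso b, is_iso c,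
        b \oc infl s = infl s' \oc a & c \oc defl s = defl s' \oc b].

(* An arrow b : mid s -> mid s' of this kind is automatically invertible when s
   and s' are conflations. *)
Definition ses_equiv Y X (s s' : ses Y X) :=
  exists b : Mor (mid s) (mid s'),
    [/\ is_iso b, b \oc infl s = infl s' & defl s' \oc b = defl s].

Definition split_ses Y X (B : biproduct Y X) : ses Y X :=
  Ses (bi_in1 B) (bi_pr2 B).

(* s' represents the image of the class of s under pushout along g. *)
Definition pushout_ses Y X Y' (g : Mor Y Y') (s : ses Y X) (s' : ses Y' X) :=
  exists h : Mor (mid s) (mid s'),
    is_pushout (infl s) g (infl s') h /\ defl s' \oc h = defl s.

(* s' represents the image of the class of s under pullback along f. *)
Definition pullback_ses Y X X' (f : Mor X' X) (s : ses Y X) (s' : ses Y X') :=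
  exists h : Mor (mid s') (mid s),
    is_pullback h (defl s') f (defl s) /\ h \oc infl s' = infl s.

(* Additive subbifunctors of Hom. *)
Record ideal := Ideal {
  in_ideal : forall X Y, Mor X Y -> Prop;
  ideal0 : forall X Y, in_ideal (0 : Mor X Y);
  idealB : forall X Y (f g : Mor X Y),
    in_ideal f -> in_ideal g -> in_ideal (f - g);
  ideal_compl : forall X Y Z (g : Mor Y Z) (f : Mor X Y),
    in_ideal f -> in_ideal (g \oc f);
  ideal_compr : forall X Y Z (g : Mor Y Z) (f : Mor X Y),
    in_ideal g -> in_ideal (g \oc f) }.

Definition ideal_ob (I : ideal) X : Prop := in_ideal I (idm X).

Definition object_ideal (I : ideal) :=
  forall X Y (f : Mor X Y), in_ideal I f ->
    exists Z (g : Mor X Z) (h : Mor Z Y), ideal_ob I Z /\ f = h \oc g.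

Definition is_precover (I : ideal) E X (p : Mor E X) :=
  in_ideal I p /\
  forall E' (f : Mor E' X), in_ideal I f -> exists g : Mor E' E, f = p \oc g.

End Preadditive.

Arguments in_ideal {A} _ {X Y} f.
Arguments ideal_ob {A} I X.
Arguments object_ideal {A} I.

Definition idempotent_complete (A : preadditive_cat) :=
  forall (X : A) (e : Mor X X), idempotent_mor e -> splits e.

Section QuotientCat.
Variables (A : preadditive_cat) (I : ideal A).

Definition ideal_pred (X Y : A) : {pred Mor X Y} :=
  fun f => `[< in_ideal I f >].

Lemma ideal_pred_zmod_closed X Y : zmod_closed (@ideal_pred X Y).
Proof.
split=> [|f g /asboolP If /asboolP Ig]; apply/asboolP; first exact: ideal0.
exact: idealB.
Qed.

HB.instance Definition _ X Y :=
  GRing.isZmodClosed.Build (Mor X Y) (@ideal_pred X Y)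
    (@ideal_pred_zmod_closed X Y).

Definition quot_hom (X Y : A) : zmodType := Quotient.quot (@ideal_pred X Y).

Definition quot_mor (X Y : A) (f : Mor X Y) : quot_hom X Y :=
  \pi_(Quotient.quot (@ideal_pred X Y)) f.

Lemma quot_morP X Y (f g : Mor X Y) :
  quot_mor f = quot_mor g <-> in_ideal I (f - g).
Proof.
split=> [/eqP|Ifg]; rewrite /quot_mor; last apply/eqP.
  by rewrite -Quotient.idealrBE => /asboolP.
by rewrite -Quotient.idealrBE; apply/asboolP.
Qed.

Lemma quot_morD X Y (f g : Mor X Y) :
  quot_mor (f + g) = quot_mor f + quot_mor g.
Proof. exact: Quotient.pi_add. Qed.

Lemma quot_mor0 X Y : quot_mor (0 : Mor X Y) = 0.
Proof. by apply: (addrI (quot_mor 0)); rewrite -quot_morD !addr0. Qed.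

Lemma quot_morK X Y (f : quot_hom X Y) : quot_mor (repr f) = f.
Proof. exact: reprK. Qed.

Definition quot_comp X Y Z (g : quot_hom Y Z) (f : quot_hom X Y) :
  quot_hom X Z := quot_mor (repr g \oc repr f).

Lemma quot_mor_comp X Y Z (g : Mor Y Z) (f : Mor X Y) :
  quot_mor (g \oc f) = quot_comp (quot_mor g) (quot_mor f).
Proof.
apply/quot_morP; set g' := repr _; set f' := repr _.
have Ig : in_ideal I (g - g') by apply/quot_morP; rewrite quot_morK.
have If : in_ideal I (f - f') by apply/quot_morP; rewrite quot_morK.
have -> : g \oc f - g' \oc f' = g \oc (f - f') - (- (g - g')) \oc f'.
  by rewrite compNl opprK compBr compBl addrA subrK.
apply: idealB; first exact: ideal_compl.
by rewrite compNl -[- _]sub0r; apply: idealB; [exact: ideal0|exact: ideal_compr].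
Qed.

Definition quot_id X : quot_hom X X := quot_mor (idm X).

Lemma quot_compA W X Y Z (h : quot_hom Y Z) (g : quot_hom X Y)
    (f : quot_hom W X) :
  quot_comp h (quot_comp g f) = quot_comp (quot_comp h g) f.
Proof.
rewrite -(quot_morK h) -(quot_morK g) -(quot_morK f).
by rewrite -!quot_mor_comp compA.
Qed.

Lemma quot_comp1m X Y (f : quot_hom X Y) : quot_comp (quot_id Y) f = f.
Proof. by rewrite -(quot_morK f) -quot_mor_comp comp1m. Qed.

Lemma quot_compm1 X Y (f : quot_hom X Y) : quot_comp f (quot_id X) = f.
Proof. by rewrite -(quot_morK f) -quot_mor_comp compm1. Qed.

Lemma quot_compDl X Y Z (g g' : quot_hom Y Z) (f : quot_hom X Y) :
  quot_comp (g + g') f = quot_comp g f + quot_comp g' f.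
Proof.
rewrite -(quot_morK g) -(quot_morK g') -(quot_morK f).
by rewrite -quot_morD -!quot_mor_comp compDl quot_morD.
Qed.

Lemma quot_compDr X Y Z (g : quot_hom Y Z) (f f' : quot_hom X Y) :
  quot_comp g (f + f') = quot_comp g f + quot_comp g f'.
Proof.
rewrite -(quot_morK g) -(quot_morK f) -(quot_morK f').
by rewrite -quot_morD -!quot_mor_comp compDr quot_morD.
Qed.

(* A/I: the objects of A, with Hom groups taken modulo I. *)
Definition quotient_cat : preadditive_cat :=
  PreadditiveCat quot_compA quot_comp1m quot_compm1 quot_compDl quot_compDr.

End QuotientCat.

Record additive_cat := AdditiveCat {
  add_pre :> preadditive_cat;
  add_zero : exists Z : add_pre, is_zero_obj Z;
  add_biproduct : forall X Y : add_pre, inhabited (biproduct X Y) }.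

Definition inflation_for (A : preadditive_cat)
    (E : forall Y X : A, ses Y X -> Prop) (Y Z : A) (i : Mor Y Z) :=
  exists (X : A) (p : Mor Z X), E Y X (Ses i p).

Definition deflation_for (A : preadditive_cat)
    (E : forall Y X : A, ses Y X -> Prop) (Z X : A) (p : Mor Z X) :=
  exists (Y : A) (i : Mor Y Z), E Y X (Ses i p).

(* Quillen's axioms, in the form given by Keller and Buehler. *)
Record exact_cat := ExactCat {
  ex_add :> additive_cat;
  conflation : forall Y X : ex_add, ses Y X -> Prop;
  conflation_ker_coker : forall Y X (s : ses Y X),
    conflation s -> kernel_cokernel s;
  conflation_iso : forall Y X Y' X' (s : ses Y X) (s' : ses Y' X'),
    ses_iso s s' -> conflation s -> conflation s';
  id_inflation : forall X : ex_add, inflation_for conflation (idm X);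
  id_deflation : forall X : ex_add, deflation_for conflation (idm X);
  inflation_comp : forall (X Y Z : ex_add) (g : Mor Y Z) (f : Mor X Y),
    inflation_for conflation f -> inflation_for conflation g ->
    inflation_for conflation (g \oc f);
  deflation_comp : forall (X Y Z : ex_add) (g : Mor Y Z) (f : Mor X Y),
    deflation_for conflation f -> deflation_for conflation g ->
    deflation_for conflation (g \oc f);
  inflation_pushout : forall (X Y X' : ex_add) (i : Mor X Y) (g : Mor X X'),
    inflation_for conflation i ->
    exists (Y' : ex_add) (j : Mor X' Y') (h : Mor Y Y'),
      is_pushout i g j h /\ inflation_for conflation j;
  deflation_pullback : forall (Y X' Y' : ex_add) (p : Mor Y Y') (f : Mor X' Y'),
    deflation_for conflation p ->
    exists (X : ex_add) (q : Mor X X') (h : Mor X Y),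
      is_pullback h q f p /\ deflation_for conflation q }.

Arguments conflation {_ _ _} s.

Section Exact.
Variable A : exact_cat.
Implicit Types B C E F P Q X Y Z : A.

Definition inflation Y Z (i : Mor Y Z) := inflation_for (@conflation A) i.
Definition deflation Z X (p : Mor Z X) := deflation_for (@conflation A) p.

Definition projective P :=
  forall E X (p : Mor E X) (f : Mor P X), deflation p ->
    exists g : Mor P E, p \oc g = f.

Definition injective_obj Q :=
  forall Y E (i : Mor Y E) (f : Mor Y Q), inflation i ->
    exists g : Mor E Q, g \oc i = f.

Definition frobenius :=
  [/\ (forall X, exists P (p : Mor P X), projective P /\ deflation p),
      (forall X, exists Q (i : Mor X Q), injective_obj Q /\ inflation i)
    & (forall X, projective X <-> injective_obj X)].

(* The class omega of projective-injective objects. *)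
Definition proj_inj X := projective X /\ injective_obj X.

Definition factors_proj_inj X Y (f : Mor X Y) :=
  exists P (g : Mor X P) (h : Mor P Y), proj_inj P /\ f = h \oc g.

Lemma proj_inj_zero Z : is_zero_obj Z -> proj_inj Z.
Proof.
move=> [Z1 Z2]; split=> [E X p f _|Y E i f _]; exists 0.
  by rewrite compm0 (Z2 _ f).
by rewrite comp0m (Z1 _ f).
Qed.

Lemma proj_inj_biproduct P Q (B : biproduct P Q) :
  proj_inj P -> proj_inj Q -> proj_inj (bi_obj B).
Proof.
move=> [Pp Pi] [Qp Qi]; split.
  move=> E X p f dp.
  have [g1 g1E] := Pp _ _ p (f \oc bi_in1 B) dp.
  have [g2 g2E] := Qp _ _ p (f \oc bi_in2 B) dp.
  exists (g1 \oc bi_pr1 B + g2 \oc bi_pr2 B).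
  by rewrite compDr !compA g1E g2E -!compA -compDr bi_sum compm1.
move=> Y E i f di.
have [g1 g1E] := Pi _ _ i (bi_pr1 B \oc f) di.
have [g2 g2E] := Qi _ _ i (bi_pr2 B \oc f) di.
exists (bi_in1 B \oc g1 + bi_in2 B \oc g2).
by rewrite compDl -!compA g1E g2E !compA -compDl bi_sum comp1m.
Qed.

Lemma factors_proj_inj0 X Y : factors_proj_inj (0 : Mor X Y).
Proof.
have [Z Z0] := add_zero A.
by exists Z, 0, 0; split; [exact: proj_inj_zero|rewrite comp0m].
Qed.

Lemma factors_proj_injB X Y (f f' : Mor X Y) :
  factors_proj_inj f -> factors_proj_inj f' -> factors_proj_inj (f - f').
Proof.
move=> [P [g [h [wP ->]]]] [Q [g' [h' [wQ ->]]]].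
have [B] := add_biproduct P Q.
exists (bi_obj B), (bi_in1 B \oc g - bi_in2 B \oc g').
exists (h \oc bi_pr1 B + h' \oc bi_pr2 B).
split; first exact: proj_inj_biproduct.
rewrite compBr !compDl !compA -!(compA h) -!(compA h').
by rewrite bi_pr1K bi_pr2K bi_pr12 bi_pr21 !comp1m !comp0m !compm0 addr0 add0r.
Qed.

Lemma factors_proj_inj_compl X Y Z (g : Mor Y Z) (f : Mor X Y) :
  factors_proj_inj f -> factors_proj_inj (g \oc f).
Proof. by move=> [P [u [h [wP ->]]]]; exists P, u, (g \oc h); rewrite compA. Qed.

Lemma factors_proj_inj_compr X Y Z (g : Mor Y Z) (f : Mor X Y) :
  factors_proj_inj g -> factors_proj_inj (g \oc f).
Proof. by move=> [P [u [h [wP ->]]]]; exists P, (u \oc f), h; rewrite compA. Qed.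

Definition proj_inj_ideal : ideal A :=
  Ideal factors_proj_inj0 factors_proj_injB factors_proj_inj_compl
    factors_proj_inj_compr.

Definition stable : preadditive_cat := quotient_cat proj_inj_ideal.

Definition stable_mor X Y (f : Mor X Y) : Mor (X : stable) (Y : stable) :=
  quot_mor proj_inj_ideal f.

(* s is the zero element of Ext^1(X, Y). *)
Definition ext_zero Y X (s : ses Y X) :=
  exists B : biproduct Y X, ses_equiv s (split_ses B).

(* Ext^1(f, g) = 0 : Ext^1(X1, Y0) -> Ext^1(X0, Y1), evaluated on arbitrary
   representatives s of a class, s' of its pullback along f and s'' of the
   pushout of s' along g. *)
Definition ext_map_zero X0 X1 Y0 Y1 (f : Mor X0 X1) (g : Mor Y0 Y1) :=
  forall (s : ses Y0 X1) (s' : ses Y0 X0) (s'' : ses Y1 X0),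
    conflation s -> conflation s' -> conflation s'' ->
    pullback_ses f s s' -> pushout_ses g s' s'' -> ext_zero s''.

Definition left_perp (J : ideal A) X0 X1 (f : Mor X0 X1) :=
  forall Y0 Y1 (g : Mor Y0 Y1), in_ideal J g -> ext_map_zero f g.

Definition right_perp (I : ideal A) Y0 Y1 (g : Mor Y0 Y1) :=
  forall X0 X1 (f : Mor X0 X1), in_ideal I f -> ext_map_zero f g.

Definition ideal_cotorsion_pair (I J : ideal A) :=
  (forall X0 X1 (f : Mor X0 X1), in_ideal I f <-> left_perp J f) /\
  (forall Y0 Y1 (g : Mor Y0 Y1), in_ideal J g <-> right_perp I g).

Definition special_ideal_precover (I : ideal A) E X (p : Mor E X) :=
  is_precover I p /\
  exists Y B (g : Mor Y B) (s : ses Y X) (j : Mor B E),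
    [/\ conflation s, right_perp I g, conflation (Ses j p)
      & pushout_ses g s (Ses j p)].

Definition has_special_ideal_precover (I : ideal A) X :=
  exists E (p : Mor E X), special_ideal_precover I p.

Definition t_structure_type (F C : A -> Prop) :=
  forall X Y, F X -> C Y -> forall f : Mor (X : stable) (Y : stable), f = 0.

Definition has_special_precover (F C : A -> Prop) X :=
  exists Y Z (i : Mor Y Z) (p : Mor Z X),
    [/\ conflation (Ses i p), F Z & C Y].

End Exact.

Arguments frobenius A : clear implicits.
Arguments stable A : clear implicits.

(* Main.v *)
From mathcomp Require Import all_boot ssralg.
Require Import Defs.

Set Implicit Arguments.
Unset Strict Implicit.
Unset Printing Implicit Defensive.

Import GRing.Theory.
Local Open Scope ring_scope.

(** Factor the morphism Y -> B of the given special precover as Y -> C0 -> B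
    through an object of J.  The pushout of the conflation along Y -> C0 is a
    conflation C0 -> G -> X, whose deflation q factors through the precover and
    therefore lies in I.  Factor q in turn as b a with a : G -> F0 and F0 in I;
    since Ext(F0, C0) = 0, b lifts to v : F0 -> G.  Then q (1 - v a) = 0, so
    1 - v a = iota t.  As t v : F0 -> C0 is stably zero, iota t is a stable
    idempotent ([stable_idempotent]).

    Now let iota t split stably.  In a triangulated category the complement
    v a = 1 - iota t then splits as well, so that G is stably F1 + Y, with F1 a
    stable summand of F0.  This is carried out inside the exact category in
    [stable_splits_complement], by replacing a stable retraction G -> Y with a
    genuinely split deflation from G + P, with P projective.  After
    [stable_splits_deflation] the composite F1 -> G -> X is a deflation; it is
    the special precover.  Its kernel K is right orthogonal to I: this is the
    long exact Ext sequence together with the vanishing of Ext(F', C0) and of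
    stable Hom(F', C0) for objects F' of I, spelled out with lifts and
    extensions in [kernel_in_right_class]. *)

(** * Kernels, cokernels and splittings *)

Section Preadditive.
Variable A : preadditive_cat.
Implicit Types W X Y Z : A.

Lemma kernel_mono X Y Z W (i : Mor X Y) (p : Mor Y Z) (x y : Mor W X) :
  is_kernel i p -> i \oc x = i \oc y -> x = y.
Proof.
move=> [pi0 ker] ixy.
have [|k [_ kU]] := ker W (i \oc x); first by rewrite compA pi0 comp0m.
by rewrite -(kU x) // -(kU y).
Qed.

Lemma cokernel_epi X Y Z W (i : Mor X Y) (p : Mor Y Z) (x y : Mor Z W) :
  is_cokernel i p -> x \oc p = y \oc p -> x = y.
Proof.
move=> [pi0 coker] xyp.
have [|k [_ kU]] := coker W (x \oc p); first by rewrite -compA pi0 compm0.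
by rewrite -(kU x) // -(kU y).
Qed.

Lemma kernel_factor X Y Z W (i : Mor X Y) (p : Mor Y Z) (h : Mor W Y) :
  is_kernel i p -> p \oc h = 0 -> exists k, i \oc k = h.
Proof. by move=> [_ ker] /ker [k [ik _]]; exists k. Qed.

Lemma cokernel_factor X Y Z W (i : Mor X Y) (p : Mor Y Z) (h : Mor Y W) :
  is_cokernel i p -> h \oc i = 0 -> exists k, k \oc p = h.
Proof. by move=> [_ coker] /coker [k [kp _]]; exists k. Qed.

Lemma pushout_ext X Y X' Y' W (i : Mor X Y) (g : Mor X X') (j : Mor X' Y')
    (h : Mor Y Y') (x y : Mor Y' W) :
  is_pushout i g j h -> x \oc h = y \oc h -> x \oc j = y \oc j -> x = y.
Proof.
move=> [hi univ] xyh xyj.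
have [|k [_ kU]] := univ W (x \oc h) (x \oc j); first by rewrite -!compA hi.
by rewrite -(kU x) // -(kU y).
Qed.

Lemma pullback_ext X Y X' Y' W (i : Mor X Y) (g : Mor X X') (j : Mor X' Y')
    (h : Mor Y Y') (x y : Mor W X) :
  is_pullback i g j h -> i \oc x = i \oc y -> g \oc x = g \oc y -> x = y.
Proof.
move=> [hi univ] xyi xyg.
have [|k [_ kU]] := univ W (i \oc x) (g \oc x); first by rewrite !compA hi.
by rewrite -(kU x) // -(kU y).
Qed.

Lemma is_iso_idm X : is_iso (idm X).
Proof. by exists (idm X); rewrite comp1m. Qed.

Lemma pushout_ses_id Y X (s : ses Y X) : pushout_ses (idm Y) s s.
Proof.
exists (idm _); split; last by rewrite compm1.
split; first by rewrite comp1m compm1.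
move=> W u w; rewrite compm1 => <-; exists u.
by split=> [|k [<- _]]; rewrite compm1.
Qed.

Lemma pullback_ses_id Y X (s : ses Y X) : pullback_ses (idm X) s s.
Proof.
exists (idm _); split; last by rewrite comp1m.
split; first by rewrite comp1m compm1.
move=> W u w; rewrite comp1m => <-; exists u.
by split=> [|k [<- _]]; rewrite comp1m.
Qed.

Lemma section_retraction Y X (s : ses Y X) (u : Mor X (mid s)) :
    kernel_cokernel s -> defl s \oc u = idm X ->
  exists r : Mor (mid s) Y,
    r \oc infl s = idm Y /\ infl s \oc r = idm _ - u \oc defl s.
Proof.
move=> [ker _] pu1; have pi0 := ker.1.
have [|r ir] := kernel_factor (h := idm _ - u \oc defl s) ker.
  by rewrite compBr compm1 compA pu1 comp1m subrr.
exists r; split=> //; apply: (kernel_mono ker).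
by rewrite compA ir compBl comp1m -compA pi0 compm0 subr0 compm1.
Qed.

Lemma retraction_section Y X (s : ses Y X) (r : Mor (mid s) Y) :
    kernel_cokernel s -> r \oc infl s = idm Y ->
  exists u : Mor X (mid s), defl s \oc u = idm X.
Proof.
move=> [ker coker] ri1; have pi0 := ker.1.
have [|u up] := cokernel_factor (h := idm _ - infl s \oc r) coker.
  by rewrite compBl comp1m -compA ri1 compm1 subrr.
exists u; apply: (cokernel_epi coker).
by rewrite -compA up compBr compm1 compA pi0 comp0m subr0 comp1m.
Qed.

(** The vanishing of an extension class, stated with an equivalence to a split
    sequence, becomes a lifting property that can be manipulated directly. *)
Lemma ext_zero_iff Y X (s : ses Y X) : kernel_cokernel s ->
  (exists B : biproduct Y X, ses_equiv s (split_ses B)) <->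
  (exists u : Mor X (mid s), defl s \oc u = idm X).
Proof.
move=> kc; have pi0 := kc.1.1; split.
  move=> [B [b [[c [_ bc]] bi pb]]]; exists (c \oc bi_in2 B).
  by rewrite -pb compA -(compA _ b) bc compm1 bi_pr2K.
move=> [u pu1]; have [r [ri1 ir]] := section_retraction kc pu1.
have ru0 : r \oc u = 0.
  apply: (kernel_mono kc.1).
  by rewrite compA ir compBl comp1m -compA pu1 compm1 subrr compm0.
have irup : infl s \oc r + u \oc defl s = idm _ by rewrite ir subrK.
exists (Biproduct ri1 pu1 ru0 pi0 irup), (idm _).
by split; rewrite ?comp1m ?compm1 //; exact: is_iso_idm.
Qed.

(** The shear (x, y) |-> (x, y + f x) is an automorphism of the biproduct, so
    its second component is again the second projection of a biproduct. *)
Definition shear_biproduct X Y (B : biproduct X Y) (f : Mor X Y) :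
  biproduct X Y.
Proof.
refine (@Biproduct _ X Y (bi_obj B) (bi_in1 B - bi_in2 B \oc f) (bi_in2 B)
  (bi_pr1 B) (bi_pr2 B + f \oc bi_pr1 B) _ _ _ _ _).
- by rewrite compBr bi_pr1K compA bi_pr12 comp0m subr0.
- by rewrite compDl bi_pr2K -compA bi_pr12 compm0 addr0.
- exact: bi_pr12.
- rewrite compBr !compDl bi_pr21 -!compA bi_pr1K !(compA (bi_pr1 B)).
  rewrite (compA (bi_pr2 B)) bi_pr12 bi_pr2K.
  by rewrite comp0m compm0 comp1m compm1 addr0 add0r subrr.
rewrite compBl compDr -compA (addrC (_ \oc bi_pr2 B)) compA addrA subrK.
exact: bi_sum.
Defined.

End Preadditive.

(** * Conflations *)

Section Exact.
Variable A : exact_cat.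
Implicit Types W X Y Z P Q : A.

Lemma conflation_pushout Y X Y' (s : ses Y X) (g : Mor Y Y') :
  conflation s -> exists s' : ses Y' X, conflation s' /\ pushout_ses g s s'.
Proof.
move=> cs; have [ker coker] := conflation_ker_coker cs.
have [|E [j [h [po [X0 [p0 c0]]]]]] := inflation_pushout (i := infl s) g.
  by exists X, (defl s); case: s {ker coker} cs.
have [ker0 coker0] := conflation_ker_coker c0; have /= p0j := ker0.1.
have [|q [[qh qj] _]] := po.2 X (defl s) 0; first by rewrite comp0m ker.1.
have [c /= cp0] := cokernel_factor coker0 qj.
have [|d dp] := cokernel_factor (h := p0 \oc h) coker.
  by rewrite -compA po.1 compA p0j comp0m.
exists (Ses j q); split; last by exists h.
have dq : d \oc q = p0.
  by apply: (pushout_ext po); rewrite -compA ?qh ?qj ?compm0 ?p0j.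
apply: (conflation_iso _ c0).
exists (idm _), (idm _), c; split=> /=; try exact: is_iso_idm.
- exists d; split.
    by apply: (cokernel_epi coker0); rewrite -compA /= cp0 dq comp1m.
  by apply: (cokernel_epi coker); rewrite -compA dp compA cp0 qh comp1m.
- by rewrite comp1m compm1.
- by rewrite compm1 cp0.
Qed.

Lemma conflation_pullback Y X X' (s : ses Y X) (f : Mor X' X) :
  conflation s -> exists s' : ses Y X', conflation s' /\ pullback_ses f s s'.
Proof.
move=> cs; have [ker coker] := conflation_ker_coker cs.
have [|E [q [h [pb [Y0 [i0 c0]]]]]] := deflation_pullback (p := defl s) f.
  by exists Y, (infl s); case: s {ker coker} cs.
have [ker0 coker0] := conflation_ker_coker c0; have /= qi0 := ker0.1.
have [|j [[hj qj] _]] := pb.2 Y (infl s) 0; first by rewrite compm0 ker.1.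
have [b /= ib] := kernel_factor ker0 qj.
have [|a ia] := kernel_factor (h := h \oc i0) ker.
  by rewrite compA pb.1 -compA qi0 compm0.
exists (Ses j q); split; last by exists h.
have ja : j \oc a = i0.
  by apply: (pullback_ext pb); rewrite compA ?hj ?qj ?comp0m ?qi0.
apply: (conflation_iso _ c0).
exists a, (idm _), (idm _); split=> /=; try exact: is_iso_idm.
- exists b; split.
    by apply: (kernel_mono ker0); rewrite /= compA ib ja compm1.
  by apply: (kernel_mono ker); rewrite compA ia -compA ib hj compm1.
- by rewrite comp1m ja.
- by rewrite comp1m compm1.
Qed.

Lemma pullback_deflation Y X Y' X' (h : Mor Y' Y) (q : Mor Y' X')
    (f : Mor X' X) (p : Mor Y X) :
  is_pullback h q f p -> deflation p -> deflation q.
Proof.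
move=> pb dp; have [E [q' [h' [pb' [Y0 [i0 c0]]]]]] := deflation_pullback f dp.
have [k [[hk qk] _]] := pb'.2 _ _ _ pb.1.
have [l [[hl ql] _]] := pb.2 _ _ _ pb'.1.
exists Y0, (l \oc i0); apply: (conflation_iso _ c0).
exists (idm _), l, (idm _); split=> /=; try exact: is_iso_idm.
- exists k; split.
    by apply: (pullback_ext pb'); rewrite compA ?hk ?hl ?qk ?ql compm1.
  by apply: (pullback_ext pb); rewrite compA ?hl ?hk ?ql ?qk compm1.
- by rewrite compm1.
- by rewrite comp1m.
Qed.

(** The second projection is the pullback of X -> 0. *)
Lemma deflation_bi_pr2 X Y (B : biproduct X Y) : deflation (bi_pr2 B).
Proof.
have [Z [p c]] := id_inflation X.
have [[/= p0 _] [_ coker]] := conflation_ker_coker c.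
rewrite compm1 in p0.
apply: (@pullback_deflation _ _ _ _ (bi_pr1 B) (bi_pr2 B) 0 p); last first.
  by exists X, (idm X).
split=> [|W u w _]; first by rewrite p0 !comp0m.
exists (bi_in1 B \oc u + bi_in2 B \oc w); split.
  rewrite !compDr !compA bi_pr1K bi_pr2K bi_pr12 bi_pr21.
  by rewrite !comp0m !comp1m addr0 add0r.
by move=> k [<- <-]; rewrite !compA -compDl bi_sum comp1m.
Qed.

(** The copairing of f and p factors as X + P -> X + Y -> Y: a pullback of p,
    then the second projection of a sheared biproduct. *)
Lemma deflation_copair X P Y (B : biproduct X P) (f : Mor X Y) (p : Mor P Y) :
  deflation p -> deflation (f \oc bi_pr1 B + p \oc bi_pr2 B).
Proof.
move=> dp; have [D] := add_biproduct X Y.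
pose u := bi_in1 D \oc bi_pr1 B + bi_in2 D \oc (p \oc bi_pr2 B).
have u1 : bi_pr1 D \oc u = bi_pr1 B.
  by rewrite compDr !compA bi_pr1K bi_pr12 !comp0m comp1m addr0.
have u2 : bi_pr2 D \oc u = p \oc bi_pr2 B.
  by rewrite compDr !compA bi_pr2K bi_pr21 !comp0m comp1m add0r.
have du : deflation u.
  apply: (@pullback_deflation _ _ _ _ (bi_pr2 B) u (bi_pr2 D) p) => //.
  split=> // W x w pxw; exists (bi_in1 B \oc (bi_pr1 D \oc w) + bi_in2 B \oc x).
  have k1 : bi_pr1 B \oc (bi_in1 B \oc (bi_pr1 D \oc w) + bi_in2 B \oc x)
            = bi_pr1 D \oc w.
    by rewrite compDr !compA bi_pr1K bi_pr12 comp0m comp1m addr0.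
  have k2 : bi_pr2 B \oc (bi_in1 B \oc (bi_pr1 D \oc w) + bi_in2 B \oc x) = x.
    by rewrite compDr !compA bi_pr2K bi_pr21 !comp0m comp1m add0r.
  split=> [|k [<- <-]].
    split=> //; rewrite compDl -!compA k1 k2 pxw compA compA -compDl bi_sum.
    by rewrite comp1m.
  by rewrite (compA (bi_pr1 D)) u1 !compA -compDl bi_sum comp1m.
have -> : f \oc bi_pr1 B + p \oc bi_pr2 B = bi_pr2 (shear_biproduct D f) \oc u.
  by rewrite /= compDl u2 -compA u1 addrC.
by apply: (deflation_comp du); exact: (deflation_bi_pr2 (shear_biproduct D f)).
Qed.

End Exact.

(** * The stable category *)

Section Stable.
Variable A : exact_cat.
Hypothesis hA : frobenius A.
Implicit Types W X Y Z P G : A.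

Lemma stable_morP X Y (f g : Mor X Y) :
  stable_mor f = stable_mor g <-> factors_proj_inj (f - g).
Proof. exact: quot_morP. Qed.

Lemma stable_mor_comp X Y Z (g : Mor Y Z) (f : Mor X Y) :
  stable_mor (g \oc f) = stable_mor g \oc stable_mor f.
Proof. exact: quot_mor_comp. Qed.

Lemma stable_morD X Y (f g : Mor X Y) :
  stable_mor (f + g) = stable_mor f + stable_mor g.
Proof. exact: quot_morD. Qed.

Lemma stable_mor0 X Y : stable_mor (0 : Mor X Y) = 0.
Proof. exact: quot_mor0. Qed.

Lemma stable_morN X Y (f : Mor X Y) : stable_mor (- f) = - stable_mor f.
Proof.
by apply: (addrI (stable_mor f)); rewrite -stable_morD !subrr stable_mor0.
Qed.

Lemma stable_mor_surj X Y (f : Mor (X : stable A) (Y : stable A)) :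
  exists g : Mor X Y, stable_mor g = f.
Proof. by exists (generic_quotient.repr f); exact: quot_morK. Qed.

Lemma projective_proj_inj P : projective P -> proj_inj P.
Proof. by move=> pP; split=> //; case: hA => _ _ /(_ P) [/(_ pP)]. Qed.

Lemma stable_mor_proj_inj X P Y (g : Mor P Y) (f : Mor X P) :
  projective P -> stable_mor (g \oc f) = 0.
Proof.
move=> pP; rewrite -(stable_mor0 X Y); apply/stable_morP; rewrite subr0.
by exists P, f, g; split=> //; exact: projective_proj_inj.
Qed.

(** If r and s represent a stable splitting of e through Y, then r s = 1 + p g
    for any deflation p : P -> Y from a projective and a suitable g.  So the
    copairing G + P -> Y of r and p is a deflation with an honest section,
    given by s and -g.  Its kernel is a summand of G + P complementary to Y,
    hence of G in the stable category. *)
Lemma stable_splits_complement G (e : Mor G G) : splits (stable_mor e) ->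
  exists F (m : Mor F G) (n : Mor G F),
    stable_mor (n \oc m) = stable_mor (idm F) /\
    stable_mor (m \oc n) = stable_mor (idm G - e).
Proof.
move=> [Y [r' [s' [sr rs]]]].
have [r rE] := stable_mor_surj r'; have [s sE] := stable_mor_surj s'.
have [srE rsE] :
    stable_mor (s \oc r) = stable_mor e /\
    stable_mor (r \oc s) = stable_mor (idm (Y : A)).
  by rewrite !stable_mor_comp rE sE.
have [W [d [c [[pW _] cd]]]] := (stable_morP _ _).1 rsE.
have [/(_ Y) [P [p [pP dp]]] _ _] := hA.
have [c' c'E] := pW _ _ p c dp; have [B] := add_biproduct G P.
have [F [k cF]] := deflation_copair B r dp.
set D := _ + _ in cF.
have Din1 : D \oc bi_in1 B = r.
  by rewrite compDl -!compA bi_pr1K bi_pr21 compm0 addr0 compm1.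
have Din2 : D \oc bi_in2 B = p.
  by rewrite compDl -!compA bi_pr2K bi_pr12 compm0 add0r compm1.
pose u := bi_in1 B \oc s - bi_in2 B \oc (c' \oc d).
have Du : D \oc u = idm (Y : A).
  by rewrite compBr !compA Din1 Din2 -(compA p) compA c'E -cd subKr.
have pru : bi_pr1 B \oc u = s.
  by rewrite compBr !compA bi_pr1K bi_pr12 !comp0m subr0 comp1m.
have kcF := conflation_ker_coker cF.
have [l /= [lk kl]] := section_retraction kcF Du.
exists F, (bi_pr1 B \oc k), (l \oc bi_in1 B); split.
  rewrite -compA (compA (bi_in1 B)).
  have -> : bi_in1 B \oc bi_pr1 B = idm _ - bi_in2 B \oc bi_pr2 B.
    by rewrite -(bi_sum B) addrK.
  rewrite compBl comp1m compBr lk stable_morD stable_morN -!compA (compA l).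
  by rewrite (stable_mor_proj_inj _ _ pP) subr0.
rewrite -compA (compA k) kl compBl comp1m compBr bi_pr1K -compA Din1.
by rewrite compA pru !stable_morD !stable_morN srE.
Qed.

(** Adding to F a projective that covers X does not change F in the stable
    category, and makes the composite to X a deflation. *)
Lemma stable_splits_deflation G F X (m : Mor F G) (n : Mor G F) (q : Mor G X) :
    stable_mor (n \oc m) = stable_mor (idm F) -> deflation q ->
  exists F' (m' : Mor F' G) (n' : Mor G F'),
    [/\ stable_mor (n' \oc m') = stable_mor (idm F'),
        m' \oc n' = m \oc n & deflation (q \oc m')].
Proof.
move=> nm dq; have [/(_ X) [P [p [pP dp]]] _ _] := hA.
have [p' p'E] := pP _ _ q p dq; have [B] := add_biproduct F P.
exists (bi_obj B), (m \oc bi_pr1 B + p' \oc bi_pr2 B), (bi_in1 B \oc n).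
split.
- rewrite compDr stable_morD (compA _ p') (stable_mor_proj_inj _ _ pP) addr0.
  rewrite -compA (compA n) stable_mor_comp (stable_mor_comp (n \oc m)) nm.
  rewrite -!stable_mor_comp comp1m -(bi_sum B) stable_morD.
  by rewrite (stable_mor_proj_inj _ _ pP) addr0.
- rewrite compDl -!compA (compA (bi_pr1 B)) (compA (bi_pr2 B)).
  by rewrite bi_pr1K bi_pr21 comp0m compm0 addr0 comp1m.
by rewrite compDr !compA p'E; exact: deflation_copair.
Qed.

End Stable.

(** * Cotorsion pairs of objects *)

Section Cotorsion.
Variables (A : exact_cat) (I J : ideal A).
Hypotheses (hA : frobenius A) (hIJ : ideal_cotorsion_pair I J).
Hypothesis hI : object_ideal I.
Hypothesis ht : t_structure_type (ideal_ob I) (ideal_ob J).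
Implicit Types C F K P X Y Z : A.

Lemma cotorsion_split F C (s : ses C F) :
  ideal_ob I F -> ideal_ob J C -> conflation s ->
  exists u, defl s \oc u = idm F.
Proof.
move=> hF hC cs; apply/(ext_zero_iff (conflation_ker_coker cs)).
have perp := (hIJ.1 _ _ (idm F)).1 hF _ _ (idm C) hC.
by apply: (perp s s s) => //; [exact: pullback_ses_id|exact: pushout_ses_id].
Qed.

Lemma cotorsion_extend F C K (s : ses K F) (c : Mor K C) :
  ideal_ob I F -> ideal_ob J C -> conflation s ->
  exists d, d \oc infl s = c.
Proof.
move=> hF hC cs; have [s' [cs' [h [po _]]]] := conflation_pushout c cs.
have [u pu1] := cotorsion_split hF hC cs'.
have [r [ri1 _]] := section_retraction (conflation_ker_coker cs') pu1.
by exists (r \oc h); rewrite -compA po.1 compA ri1 comp1m.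
Qed.

Lemma cotorsion_lift F C X (s : ses C X) (f : Mor F X) :
  ideal_ob I F -> ideal_ob J C -> conflation s ->
  exists g, defl s \oc g = f.
Proof.
move=> hF hC cs; have [s' [cs' [h [pb _]]]] := conflation_pullback f cs.
have [u pu1] := cotorsion_split hF hC cs'.
by exists (h \oc u); rewrite compA pb.1 -compA pu1 compm1.
Qed.

Lemma projective_ideal_ob P : projective P -> ideal_ob I P.
Proof.
move=> pP; apply/(hIJ.1 _ _ (idm P)) => Y0 Y1 g _ s s' s'' _ _ cs'' _ _.
apply/(ext_zero_iff (conflation_ker_coker cs'')); apply: pP.
by exists Y1, (infl s''); case: s'' cs''.
Qed.

(** I contains the identities of projectives, hence every morphism that is
    stably zero. *)
Lemma stable_mor_ideal X Y (f g : Mor X Y) :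
  stable_mor f = stable_mor g -> in_ideal I g -> in_ideal I f.
Proof.
move=> /stable_morP [P [u [h [[pP _] fg]]]] Ig.
rewrite -(subrK g f) fg -[g]opprK; apply: idealB.
  rewrite -(comp1m u); apply: ideal_compl; apply: ideal_compr.
  exact: projective_ideal_ob.
by rewrite -sub0r; apply: idealB; [exact: ideal0|].
Qed.

(** Since I is an object ideal, orthogonality to its objects is orthogonality
    to the whole ideal. *)
Lemma right_perp_ob K :
    (forall F (s : ses K F), ideal_ob I F -> conflation s ->
       exists u, defl s \oc u = idm F) ->
  ideal_ob J K.
Proof.
move=> hK; apply/(hIJ.2 _ _ (idm K)) => X0 X1 f If s s' s'' cs _ cs''.
move=> [h' [pb _]] [h'' [_ ps'']].
have [F [a [b [hF fE]]]] := hI If.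
have [t [ct [k [pt _]]]] := conflation_pullback b cs.
have [u pu1] := hK _ _ hF ct.
have [|w [[_ pw1] _]] := pb.2 _ (k \oc (u \oc a)) (idm X0).
  by rewrite !compA pt.1 -(compA b) pu1 !compm1 fE.
apply/(ext_zero_iff (conflation_ker_coker cs'')).
by exists (h'' \oc w); rewrite compA ps''.
Qed.

Lemma t_structure_comp F C X (f : Mor F C) (g : Mor C X) :
  ideal_ob I F -> ideal_ob J C -> stable_mor (g \oc f) = 0.
Proof.
by move=> hF hC; rewrite stable_mor_comp (ht hF hC (stable_mor f)) compm0.
Qed.

(** Let 1_F' be in I and x in Ext(F', K).  The image of x under
    Ext(F', K) -> Ext(F', F1) -> Ext(F', G) dies in Ext(F', X), and so comes
    from Ext(F', C0) = 0; as m is a split monomorphism in the stable category,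
    x already dies in Ext(F', F1).  Hence x comes from Hom(F', X), and every
    w : F' -> X lifts to G because Ext(F', C0) = 0, then to F1 because
    (iota t) w factors stably through Hom(F', C0) = 0. *)
Lemma kernel_in_right_class C0 G F1 X K (iota : Mor C0 G) (q : Mor G X)
    (t : Mor G C0) (m : Mor F1 G) (n : Mor G F1) (j : Mor K F1) :
    ideal_ob J C0 -> conflation (Ses iota q) ->
    stable_mor (n \oc m) = stable_mor (idm F1) ->
    stable_mor (m \oc n) = stable_mor (idm G - iota \oc t) ->
    conflation (Ses j (q \oc m)) ->
  ideal_ob J K.
Proof.
move=> hC0 cq nm mn cj; apply: right_perp_ob => F' s hF' cs.
have [kerq _] := conflation_ker_coker cq.
have [kerj _] := conflation_ker_coker cj; have /= qmj0 := kerj.1.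
have [_ cokers] := conflation_ker_coker cs.
(* The class of s dies in Ext(F', F1). *)
have [u uj] : exists u, u \oc infl s = j.
  have [|c /= cE] := kernel_factor (h := m \oc j) kerq.
    by rewrite /= compA.
  have [d dE] := cotorsion_extend c hF' hC0 cs.
  have [W [g [h [[_ iW] nmE]]]] := (stable_morP _ _).1 nm.
  have [|g' g'E] := iW _ _ (infl s) (g \oc j).
    by exists F', (defl s); case: s cs {cokers d dE}.
  exists (n \oc (iota \oc d) - h \oc g').
  rewrite compBl -!compA dE cE g'E !compA -nmE compBl comp1m.
  exact: subKr.
have [|w wE] := cokernel_factor (h := q \oc m \oc u) cokers.
  by rewrite -compA uj.
(* Correcting u by a lift of w makes it a retraction of infl s. *)
have [w' w'E] : exists w', q \oc m \oc w' = w.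
  have [w1 /= w1E] := cotorsion_lift w hF' hC0 cq.
  have : stable_mor w1 = stable_mor (m \oc (n \oc w1)).
    rewrite compA (stable_mor_comp _ w1) mn -stable_mor_comp compBl comp1m.
    rewrite stable_morD stable_morN -compA.
    by rewrite (t_structure_comp _ _ hF' hC0) subr0.
  move=> /stable_morP [W [g [h [[pW _] w1m]]]].
  have [|h' h'E] := pW _ _ (q \oc m) (q \oc h); first by exists K, j.
  exists (n \oc w1 + h' \oc g).
  rewrite compDr [X in _ + X]compA h'E -!compA -w1m -compDr addrC.
  by rewrite subrK.
have [|r rE] := kernel_factor (h := u - w' \oc defl s) kerj.
  by rewrite /= compBr [X in _ - X]compA w'E wE subrr.
apply: (retraction_section (r := r) (conflation_ker_coker cs)).
have [[si0 _] _] := conflation_ker_coker cs.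
apply: (kernel_mono kerj); rewrite compA rE /= compBl uj -compA si0.
by rewrite compm0 subr0 compm1.
Qed.

(** F1 lies in I because its stable identity is n m = n (m n) m = n v a m, which
    factors through F0. *)
Lemma special_precover_of_splitting C0 G F0 X (iota : Mor C0 G) (q : Mor G X)
    (a : Mor G F0) (v : Mor F0 G) (t : Mor G C0) :
    ideal_ob J C0 -> ideal_ob I F0 -> conflation (Ses iota q) ->
    idm G = v \oc a + iota \oc t -> splits (stable_mor (iota \oc t)) ->
  has_special_precover (ideal_ob I) (ideal_ob J) X.
Proof.
move=> hC0 hF0 cq vat /(stable_splits_complement hA) [F [m0 [n0 [nm0 mn0]]]].
have dq : deflation q by exists C0, iota.
have [F1 [m [n [nm mn [K [j cj]]]]]] := stable_splits_deflation hA nm0 dq.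
rewrite -mn in mn0.
exists K, F1, j, (q \oc m); split=> //; last first.
  exact: kernel_in_right_class mn0 cj.
apply: (@stable_mor_ideal _ _ _ (n \oc (v \oc (a \oc m)))).
  have va : idm G - iota \oc t = v \oc a by rewrite vat addrK.
  rewrite va in mn0.
  rewrite (compA v) stable_mor_comp (stable_mor_comp (v \oc a)) -mn0.
  rewrite -!stable_mor_comp -compA (compA n) stable_mor_comp nm.
  by rewrite -stable_mor_comp comp1m.
rewrite -(comp1m (a \oc m)).
by do 2!apply: ideal_compl; exact: ideal_compr.
Qed.

(** The defect iota t - (iota t)^2 = iota (t v) a factors through
    t v : F0 -> C0, which is stably zero. *)
Lemma stable_idempotent C0 G F0 (iota : Mor C0 G)
    (a : Mor G F0) (v : Mor F0 G) (t : Mor G C0) :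
    ideal_ob J C0 -> ideal_ob I F0 -> idm G = v \oc a + iota \oc t ->
  idempotent_mor (stable_mor (iota \oc t)).
Proof.
move=> hC0 hF0 vat; rewrite /idempotent_mor -stable_mor_comp.
have -> : iota \oc t \oc (iota \oc t) = iota \oc t - iota \oc (t \oc v) \oc a.
  have {2}-> : iota \oc t = idm G - v \oc a by rewrite vat addrC addKr.
  by rewrite compBr compm1 !compA.
rewrite stable_morD stable_morN (stable_mor_comp _ a).
by rewrite (t_structure_comp _ _ hF0 hC0) comp0m subr0.
Qed.

End Cotorsion.

Theorem proposition5p6 (A : exact_cat) (hA : frobenius A) (I J : ideal A)
    (hIJ : ideal_cotorsion_pair I J)
    (hI : object_ideal I) (hJ : object_ideal J)
    (ht : t_structure_type (ideal_ob I) (ideal_ob J))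
    (X : A) (hX : has_special_ideal_precover I X) :
  exists (C0 G : A) (iota : Mor C0 G) (q : Mor G X),
    conflation (Ses iota q) /\ ideal_ob J C0 /\ in_ideal I q /\
    exists (F0 : A) (a : Mor G F0) (v : Mor F0 G) (t : Mor G C0),
      ideal_ob I F0 /\
      idm G = v \oc a + iota \oc t /\
      idempotent_mor (stable_mor (iota \oc t)) /\
      (splits (stable_mor (iota \oc t)) ->
         has_special_precover (ideal_ob I) (ideal_ob J) X) /\
      (idempotent_complete (stable A) ->
         has_special_precover (ideal_ob I) (ideal_ob J) X).
Proof.
have [E [p [[Ip _] [Y [B [g [s [j [cs /(hIJ.2 _ _ g).2 Jg cp pg]]]]]]]]] := hX.
have [h0 [/= po0 ph0]] := pg.
have [C0 [g1 [g2 [hC0 gE]]]] := hJ _ _ _ Jg.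
have [s1 [cs1 [h [po ph]]]] := conflation_pushout g1 cs.
case: s1 cs1 h po ph => G iota q cq h /= po ph.
have [/= qi0 _] := (conflation_ker_coker cq).1.
have [/= pj0 _] := (conflation_ker_coker cp).1.
have [|k [[kh ki] _]] := po.2 E h0 (j \oc g2); first by rewrite po0.1 gE compA.
have qE : q = p \oc k.
  apply: (pushout_ext po); rewrite -compA ?kh ?ki ?ph ?ph0 //.
  by rewrite compA pj0 comp0m.
have Iq : in_ideal I q by rewrite qE; exact: ideal_compr.
have [F0 [a [b [hF0 qba]]]] := hI _ _ _ Iq.
have [v /= qv] := cotorsion_lift hIJ b hF0 hC0 cq.
have [kerq _] := conflation_ker_coker cq.
have [|t /= it] := kernel_factor (h := idm G - v \oc a) kerq.
  by rewrite /= compBr compm1 compA qv -qba subrr.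
have vat : idm G = v \oc a + iota \oc t by rewrite it addrC subrK.
have idem := stable_idempotent ht hC0 hF0 vat.
have spl := special_precover_of_splitting hA hIJ hI ht hC0 hF0 cq vat.
exists C0, G, iota, q; do 3!split=> //; exists F0, a, v, t; do 4!split=> //.
by move=> /(_ _ _ idem).
Qed.
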